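(* For every graph $G$, there is a graph $G'$ with the same number of vertices as $G$ such that $G$ is a subgraph of $G'$ and such that $\lfloor \mathrm{sp}\rfloor(G)=\mathrm{sp}(G')$.
   Context: All graphs are finite, have at least one vertex, have no loops, and may have multiple (parallel) edges. A path of order $k+1$ has $k$ edges and $k+1$ distinct vertices. A shortest path from $u$ to $v$ is a $u$–$v$ path such that no $u$–$v$ path has fewer vertices. A unique shortest path is a shortest $u$–$v$ path $P$ such that every $u$–$v$ path with the same number of vertices is identical to $P$, where two paths with different edge sequences are different even if their vertex sequences agree (so no edge of a unique shortest path has a parallel edge); a single vertex is a unique shortest path. The parade number $\mathrm{usp}(G)$ is the largest number of vertices of a unique shortest path in $G$; a parade is a unique shortest path attaining it. The spectator number is $\mathrm{sp}(G)=|V(G)|-\mathrm{usp}(G)$. A minor of a graph $H$ is any graph obtained from $H$ by a sequence of the operations: deleting an isolated vertex, deleting an edge, contracting an edge that has no edge parallel to it. The spectator floor $\lfloor \mathrm{sp}\rfloor(G)$ is the minimum of $\mathrm{sp}(H)$ over all graphs $H$ of which $G$ is a minor. *)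

(* Defs.v *)
From mathcomp Require Import all_boot.
From mathcomp Require Import boolp.
From Stdlib Require Import Relation_Operators.

Set Implicit Arguments.
Unset Strict Implicit.
Unset Printing Implicit Defensive.

(* A finite loopless multigraph with at least one vertex.  Each edge e has
   endpoints gend e (stored as an ordered pair; orientation is irrelevant). *)
Record graph := Graph {
  gV : finType;
  gE : finType;
  gend : gE -> gV * gV;
  gnoloop : forall e, (gend e).1 != (gend e).2;
  gnonempty : 0 < #|gV|
}.

Definition same_ends (T : eqType) (p q : T * T) : bool :=
  (p == q) || (p == (q.2, q.1)).

Definition map_pair (A B : Type) (f : A -> B) (p : A * A) : B * B :=
  (f p.1, f p.2).

Fixpoint is_walk (G : graph) (vs : seq (gV G)) (es : seq (gE G)) : bool :=
  match vs, es with
  | [:: _], [::] => true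
  | x :: ((y :: _) as vs'), e :: es' =>
      same_ends (gend e) (x, y) && is_walk vs' es'
  | _, _ => false
  end.

Definition is_path (G : graph) (vs : seq (gV G)) (es : seq (gE G)) : bool :=
  is_walk vs es && uniq vs.

Definition uv_path (G : graph) (u v : gV G) (vs : seq (gV G)) (es : seq (gE G))
  : Prop :=
  is_path vs es /\ ohead vs = Some u /\ ohead (rev vs) = Some v.

Definition is_shortest (G : graph) (u v : gV G) vs es : Prop :=
  uv_path u v vs es /\
  forall vs' es', uv_path u v vs' es' -> size vs <= size vs'.

Definition is_unique_shortest (G : graph) (u v : gV G) vs es : Prop :=
  is_shortest u v vs es /\
  forall vs' es', uv_path u v vs' es' -> size vs' = size vs ->
    vs' = vs /\ es' = es.

Definition is_usp (G : graph) (vs : seq (gV G)) (es : seq (gE G)) : Prop :=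
  exists u v, is_unique_shortest u v vs es.

Definition usp (G : graph) : nat :=
  \max_(k < #|gV G|.+1 |
        `[< exists vs es, @is_usp G vs es /\ size vs = k >]) k.

Definition sp (G : graph) : nat := #|gV G| - usp G.

Definition del_edge (G H : graph) : Prop :=
  exists (e : gE H) (fV : gV G -> gV H) (fE : gE G -> gE H),
    bijective fV /\ injective fE /\ (forall f, fE f != e) /\
    (forall f', f' != e -> exists f, fE f = f') /\
    (forall f, same_ends (gend (fE f)) (map_pair fV (gend f))).

Definition del_isolated (G H : graph) : Prop :=
  exists (v : gV H) (fV : gV G -> gV H) (fE : gE G -> gE H),
    (forall e, v != (gend e).1 /\ v != (gend e).2) /\
    injective fV /\ (forall x, fV x != v) /\
    (forall y, y != v -> exists x, fV x = y) /\
    bijective fE /\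
    (forall f, same_ends (gend (fE f)) (map_pair fV (gend f))).

Definition contract (G H : graph) : Prop :=
  exists (e : gE H) (fV : gV H -> gV G) (fE : gE G -> gE H),
    (forall f, f != e -> ~~ same_ends (gend f) (gend e)) /\
    (forall x y, fV x = fV y ->
       x = y \/ same_ends (x, y) (gend e)) /\
    fV (gend e).1 = fV (gend e).2 /\
    (forall z, exists x, fV x = z) /\
    injective fE /\ (forall f, fE f != e) /\
    (forall f', f' != e -> exists f, fE f = f') /\
    (forall f, same_ends (gend f) (map_pair fV (gend (fE f)))).

Definition isomorphic (G H : graph) : Prop :=
  exists (fV : gV G -> gV H) (fE : gE G -> gE H),
    bijective fV /\ bijective fE /\
    (forall f, same_ends (gend (fE f)) (map_pair fV (gend f))).

Definition minor_step (G H : graph) : Prop :=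
  [\/ del_edge G H, del_isolated G H, contract G H | isomorphic G H].

Definition minor (G H : graph) : Prop :=
  clos_refl_trans graph (fun X Y => minor_step Y X) H G.

Lemma spfloor_ex (G : graph) :
  exists s, `[< exists H, minor G H /\ sp H = s >].
Proof.
exists (sp G); apply/asboolP; exists G; split=> //; exact: rt_refl.
Qed.

Definition spfloor (G : graph) : nat := ex_minn (spfloor_ex G).

Definition subgraph (G H : graph) : Prop :=
  exists (fV : gV G -> gV H) (fE : gE G -> gE H),
    injective fV /\ injective fE /\
    (forall f, same_ends (gend (fE f)) (map_pair fV (gend f))).

(* Main.v *)
(* Call a graph s-layered if it has a sequence [Q] of all but at most [s]
   vertices and an integer level function [f] such that the i-th vertex of [Q]
   is the point [i] of the line, each other vertex [x] is the unit interval
   [[f x - 1, f x]], adjacent vertices touch (consecutive points also count as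
   touching), and points are never joined by parallel edges.  A unique shortest
   path makes [G] sp(G)-layered, with [f] the distance to its first end.  Being
   s-layered passes to minors: when the edge [xy] is contracted, or [x] is
   deleted, the point [k = min (f x) (f y)] (resp. [k = f x]) leaves the path
   and the levels [k], [k + 1] are identified; this shrinks the line by one
   while the graph loses one vertex.  Finally, once its missing edges are
   added, [Q] is a unique shortest path: a walk bypassing it must traverse
   unit intervals, one more edge than the distance covered. *)
Require Import Defs.
From mathcomp Require Import all_boot.
From mathcomp Require Import boolp zify.
From Stdlib Require Import Relation_Operators.

Set Implicit Arguments.
Unset Strict Implicit.
Unset Printing Implicit Defensive.

(** * Unordered pairs of endpoints *)

Lemma same_endsC (T : eqType) (p : T * T) x y :
  same_ends p (x, y) = same_ends p (y, x).
Proof. by rewrite /same_ends orbC. Qed.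

Lemma same_ends_sym (T : eqType) (p q : T * T) :
  same_ends p q = same_ends q p.
Proof.
case: p q => [a b] [c d]; rewrite /same_ends /= !xpair_eqE.
by rewrite ![c == _]eq_sym ![d == _]eq_sym [(b == c) && _]andbC.
Qed.

Lemma same_ends_map_pair (S T : eqType) (h : S -> T) p q :
  same_ends p q -> same_ends (map_pair h p) (map_pair h q).
Proof. by case/orP => /eqP ->; rewrite /same_ends eqxx ?orbT. Qed.

Lemma same_ends_trans (T : eqType) (p q r : T * T) :
  same_ends p q -> same_ends q r -> same_ends p r.
Proof.
case: p q r => [a b] [c d] [e g] /orP[] /eqP[-> ->] //.
by rewrite same_ends_sym same_endsC same_ends_sym.
Qed.

Lemma same_ends_map_pairP (S T : eqType) (h : S -> T) p (x y : T) :
  same_ends (x, y) (map_pair h p) ->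
  exists a b, [/\ same_ends p (a, b), h a = x & h b = y].
Proof.
case: p => a b /orP[] /eqP[-> ->]; [exists a, b | exists b, a];
  by rewrite /same_ends eqxx ?orbT.
Qed.

(** * Walks and functions changing by at most one along an edge *)

Section Walks.
Variable G : graph.
Implicit Types (x y a : gV G) (p q : seq (gV G)) (es : seq (gE G)).

Lemma walk_cons x y p e es :
  is_walk [:: x, y & p] (e :: es) =
  same_ends (gend e) (x, y) && is_walk (y :: p) es.
Proof. by []. Qed.

Lemma walk_cat a p q es es' :
  is_walk (a :: p) es -> is_walk (last a p :: q) es' ->
  is_walk (a :: p ++ q) (es ++ es').
Proof.
elim: p a es => [|b p IH] a [|e es] //=.
by move=> /andP[-> w] w'; exact: IH.
Qed.

Lemma walk_split a p q es :
  is_walk (a :: p ++ q) es ->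
  exists es1 es2, [/\ es = es1 ++ es2, is_walk (a :: p) es1 &
                      is_walk (last a p :: q) es2].
Proof.
elim: p a es => [|b p IH] a es; first by move=> w; exists [::], es.
case: es => [//|e es] /andP[abe /IH[es1 [es2 [-> w1 w2]]]].
by exists (e :: es1), es2; split=> //; rewrite walk_cons abe.
Qed.

Lemma path_walk a p :
  path (fun x y => [exists e : gE G, same_ends (gend e) (x, y)]) a p ->
  exists es, is_walk (a :: p) es.
Proof.
elim: p a => [|b p IH] a; first by exists [::].
case/andP=> /existsP[e abe] /IH[es w].
by exists (e :: es); rewrite walk_cons abe.
Qed.

Lemma uv_pathP u v p es :
  uv_path u v p es <->
  exists t, [/\ p = u :: t, last u t = v, is_walk p es & uniq p].
Proof.
have rl a t : ohead (rev (a :: t)) = Some (last a t).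
  by rewrite lastI rev_rcons.
split=> [[/andP[w U] []]|[t [-> lt w U]]]; last first.
  by split; [exact/andP | split; rewrite // rl lt].
by case: p w U => [|a t] // w U [<-]; rewrite rl => -[<-]; exists t.
Qed.

Definition lipschitz (f : gV G -> nat) :=
  forall e x y, same_ends (gend e) (x, y) -> f x <= (f y).+1.

(** Each edge raises [f] by at most one; a total rise equal to the number of edges forces every edge
    to raise it by exactly one. *)
Lemma lipschitz_walk f a p es : lipschitz f -> is_walk (a :: p) es ->
  f (last a p) <= f a + size p /\
  (f (last a p) = f a + size p -> map f (a :: p) = iota (f a) (size p).+1).
Proof.
move=> fL; elim: p a es => [|b p IH] a [|e es] //; first by rewrite addn0.
rewrite walk_cons same_endsC => /andP[/fL ab /IH[le_b eq_b]]; split=> /=.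
  by lia.
move=> lastE; rewrite /= in le_b eq_b.
have fb : f b = (f a).+1 by lia.
by rewrite eq_b ?fb //; lia.
Qed.

End Walks.

(* A vertex of [Q] stands for the point [f x], any other vertex for the
   interval [[f x - 1, f x]]; the second clause says that adjacent vertices
   touch, except that consecutive points of [Q] may also be adjacent. *)
Definition layered (G : graph) (Q : seq (gV G)) (f : gV G -> nat) : Prop :=
  [/\ map f Q = iota 0 (size Q),
      forall e x y, same_ends (gend e) (x, y) ->
        f x <= f y + ((x \in Q) ==> (y \in Q)) &
      forall e1 e2 x1 y1 x2 y2,
        same_ends (gend e1) (x1, y1) -> same_ends (gend e2) (x2, y2) ->
        {subset [:: x1; y1; x2; y2] <= Q} ->
        f x1 = f x2 -> f y1 = (f x1).+1 -> f y2 = (f x2).+1 -> e1 = e2].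

(** * Level functions and the identification of two consecutive levels *)

Section Layers.
Variables (T : eqType) (Q : seq T) (f : T -> nat).
Hypothesis fQ : map f Q = iota 0 (size Q).

Lemma layers_uniq : uniq Q.
Proof. by apply: (@map_uniq _ _ f); rewrite fQ iota_uniq. Qed.

Lemma layers_nth x0 i : i < size Q -> f (nth x0 Q i) = i.
Proof. by move=> lti; rewrite -(nth_map x0 0) // fQ nth_iota. Qed.

Lemma layers_lt x : x \in Q -> f x < size Q.
Proof. by move=> /(map_f f); rewrite fQ mem_iota. Qed.

Lemma layers_nthK x0 x : x \in Q -> nth x0 Q (f x) = x.
Proof. by case/(nthP x0) => i lti <-; rewrite layers_nth. Qed.

Lemma layers_inj : {in Q &, injective f}.
Proof. by move=> x y xQ yQ fxy; rewrite -(layers_nthK x xQ) fxy layers_nthK. Qed.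

(** [unbump k] fixes the levels up to [k] and lowers the others by one, so it closes the gap left by
    [k]. For [k >= m] nothing is removed. *)
Lemma iota_unbump k m :
  map (unbump k) [seq i <- iota 0 m | i != k] = iota 0 (m - (k < m)).
Proof.
elim: m => [//|m IH].
rewrite -[in LHS]addn1 iotaD filter_cat map_cat IH add0n /= /unbump.
case: eqVneq => [->|neq] /=; first by rewrite ltnn cats0; congr iota; lia.
have -> : m.+1 - (k < m.+1) = (m - (k < m)) + 1 by lia.
by rewrite iotaD add0n.
Qed.

(** Levels are distinct on [Q], so at most one point sits at level [k]. *)
Lemma layers_collapse k (Q' := [seq x <- Q | f x != k]) :
  map (unbump k \o f) Q' = iota 0 (size Q') /\ size Q <= (size Q').+1.
Proof.
have E : map (unbump k \o f) Q' = iota 0 (size Q - (k < size Q)).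
  have -> : map (unbump k \o f) Q' = map (unbump k) [seq i <- map f Q | i != k].
    by rewrite filter_map -map_comp.
  by rewrite fQ iota_unbump.
have sQ' : size Q' = size Q - (k < size Q).
  by rewrite -(size_map (unbump k \o f)) E size_iota.
by rewrite E sQ'; split=> //; lia.
Qed.

End Layers.

Lemma layered_lipschitz G Q f : @layered G Q f -> lipschitz f.
Proof. by case=> _ fQ _ e x y /fQ; lia. Qed.

(** * From a unique shortest path to a layering *)

Section UniqueShortest.
Variables (G : graph) (vs : seq (gV G)) (es : seq (gE G)).

(** [f] is the distance from [u], with default 0 at unreachable vertices. The default keeps [f]
    Lipschitz, since a reachable vertex has only reachable neighbours; in the last clause [f x > 0]
    certifies that [x] is reachable. *)
Lemma distance_exists (u : gV G) : exists f : gV G -> nat,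
  [/\ f u = 0, lipschitz f,
      (forall p es0, is_walk (u :: p) es0 -> exists q es1,
        [/\ is_walk (u :: q) es1, last u q = last u p & size q = f (last u p)])
    & forall e x y, same_ends (gend e) (x, y) -> f x = (f y).+1 ->
        exists q es1, [/\ is_walk (u :: q) es1, last u q = y & size q = f y]].
Proof.
pose reach x n := exists q es1,
  [/\ is_walk (u :: q) es1, last u q = x & size q = n].
have /choice[f fP] x : exists n : nat,
    (reach x n /\ forall k, reach x k -> n <= k) \/
    (n = 0 /\ forall k, ~ reach x k).
  case: (pselect (exists n, `[< reach x n >])) => [ex|nex].
    case: (ex_minnP ex) => n /asboolP rn minn; exists n; left; split=> // k rk.
    by apply/minn/asboolP.
  by exists 0; right; split=> // n rn; apply: nex; exists n; apply/asboolP.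
have step e x y n : same_ends (gend e) (x, y) -> reach x n -> reach y n.+1.
  move=> xye [q [es1 [w lq sq]]]; exists (q ++ [:: y]), (es1 ++ [:: e]).
  rewrite last_cat size_cat sq addn1; split=> //.
  by apply: walk_cat w _; rewrite walk_cons lq xye.
have ru : reach u 0 by exists [::], [::].
exists f; split.
- by case: (fP u) => [[_ /(_ _ ru)]|[->//]]; rewrite leqn0 => /eqP.
- move=> e x y xye; case: (fP x) => -[rx] nrx; last by rewrite rx.
  case: (fP y) => -[ry nry]; last first.
    by case: (nry (f x).+1); exact: (step _ _ _ _ xye rx).
  by apply: nrx; apply: (step _ _ _ _ _ ry); rewrite same_endsC; exact: xye.
- move=> p es0 w; case: (fP (last u p)) => -[] // _ /(_ (size p)) [].
  by exists p, es0.
- move=> e x y xye fx; case: (fP y) => -[] // _ nry.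
  case: (fP x) => -[rx _]; last by rewrite rx in fx.
  by case: (nry (f x).+1); exact: (step _ _ _ _ xye rx).
Qed.

Lemma usp_layered : is_usp vs es -> exists f, layered vs f.
Proof.
case=> u [v [[/uv_pathP[t [-> lt w U]] short] uniqP]].
have [f [fu fL fwalk fdown]] := distance_exists u.
exists f.
(* A walk from [u] as long as the distance to its end climbs one level per edge, so its vertices are
   distinct and it competes with the given path. *)
have walk_uniq p es0 : is_walk (u :: p) es0 -> f (last u p) = size p ->
    map f (u :: p) = iota 0 (size p).+1.
  by move=> /(lipschitz_walk fL)[_]; rewrite fu.
have walk_path p es0 : is_walk (u :: p) es0 -> last u p = v ->
    f v = size p -> uv_path u v (u :: p) es0.
  move=> w0 lp fv; apply/uv_pathP; exists p; split=> //.
  apply: (@map_uniq _ _ f); rewrite (walk_uniq _ es0) ?iota_uniq //.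
  by rewrite lp.
have fv : f v = size t.
  have [q [es1 [w1 lq sq]]] := fwalk _ _ w.
  rewrite lt in lq sq.
  have := short _ _ (walk_path _ _ w1 lq (esym sq)).
  have [] := lipschitz_walk fL w; rewrite lt fu /= sq; lia.
have fQ : map f (u :: t) = iota 0 (size (u :: t)).
  by apply: walk_uniq w _; rewrite lt.
have same_walk p es0 : is_walk (u :: p) es0 -> last u p = v ->
    size p = size t -> p = t /\ es0 = es.
  move=> w0 lp sp.
  have [] := uniqP _ _ (walk_path _ _ w0 lp _); rewrite ?sp //= ?sp //.
  by case.
have split_at x : x \in u :: t -> exists p q,
    [/\ t = p ++ q, last u p = x & size p = f x].
  move=> xt; have [p [q [tE lp]]] : exists p q, t = p ++ q /\ last u p = x.
    by case/splitPl: xt => p q lp; exists p, q.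
  exists p, q; split=> //; have := layers_nth fQ u (i := size p).
  rewrite tE -cat_cons nth_cat /= ltnSn -last_nth lp size_cat => -> //; lia.
split=> //.
- move=> e x y xye; have := fL _ _ _ xye.
  case: (boolP (x \in _)) => [xQ|]; last by rewrite addn1.
  case: (boolP (y \in _)) => [_|yQ] /=; rewrite ?addn1 // addn0 => fxy.
  (* Otherwise a shortest walk to [y], the edge to [x] and the rest of the path after [x] form a
     path of the same length through [y], which is not on the given one. *)
  rewrite leqNgt; apply/negP => ltf.
  have fx : f x = (f y).+1 by lia.
  have [q1 [es1 [w1 lq1 sq1]]] := fdown _ _ _ xye fx.
  have [p [q [tE lp sp]]] := split_at _ xQ.
  move: (w); rewrite tE => /walk_split[es2 [es3 [_ _ w3]]].
  have w4 : is_walk (u :: q1 ++ x :: q) (es1 ++ e :: es3).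
    by apply: walk_cat w1 _; rewrite walk_cons lq1 same_endsC xye -lp.
  have [] := same_walk _ _ w4.
  + by rewrite last_cat /= -lt tE last_cat lp.
  + by rewrite tE !size_cat /= sq1 sp fx; lia.
  move=> E _; case/negP: yQ; rewrite -E -lq1.
  by rewrite -cat_cons mem_cat mem_last.
- move=> e1 e2 x y x2 y2 xy1 xy2 sub fxx fy fy2.
  have mem z : z \in [:: x; y; x2; y2] -> z \in u :: t by apply: sub.
  have xQ : x \in u :: t by apply: mem; rewrite inE eqxx.
  have yQ : y \in u :: t by apply: mem; rewrite !inE eqxx !orbT.
  have x2E : x2 = x.
    by apply: (layers_inj fQ) => //; apply: mem; rewrite !inE eqxx !orbT.
  have y2E : y2 = y.
    apply: (layers_inj fQ); rewrite ?fy2 ?fy ?fxx // ?mem //.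
    by rewrite !inE eqxx !orbT.
  subst x2 y2.
  have [p [[|z q] [tE lp sp]]] := split_at _ xQ.
    have := layers_lt fQ yQ; rewrite /= tE cats0 sp fy; lia.
  have zE : z = y.
    by rewrite -(layers_nthK fQ u yQ) fy -sp /= tE nth_cat ltnn subnn.
  subst z; move: (w); rewrite tE => /walk_split[es2 [[|e es3] [esE w2 //]]].
  rewrite walk_cons lp => /andP[_ w3].
  (* Exchanging the path edge between [x] and [y] for [e'] keeps the length, so uniqueness of the
     edge sequence gives [e' = e]. *)
  have repl e' : same_ends (gend e') (x, y) -> e' = e.
    move=> xye.
    have w4 : is_walk (u :: p ++ y :: q) (es2 ++ e' :: es3).
      by apply: walk_cat w2 _; rewrite walk_cons lp xye.
    have [] := same_walk _ _ w4; rewrite -?tE // esE => _ /eqP.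
    by rewrite eqseq_cat // eqxx /= eqseq_cons => /andP[/eqP].
  by rewrite (repl e1) // (repl e2).
Qed.

End UniqueShortest.

(** * Layerings pass to minors *)

(** The bound on [j] excludes a gap of two shrunk to one by the collapse. *)
Lemma unbump_succ k i j : j <= i.+1 -> unbump k j = (unbump k i).+1 -> j = i.+1.
Proof. by rewrite /unbump; lia. Qed.

Lemma unbump_inj k i j : i <> k -> j <> k -> unbump k i = unbump k j -> i = j.
Proof. by rewrite /unbump; lia. Qed.

Lemma leq_addb (i j : nat) (b : bool) : i <= j + b -> i <= j.+1.
Proof. by case: b; lia. Qed.

(** Shrinking the segment from [k] to [k + 1] preserves touching, and so does enlarging the removed
    point [k] to a unit interval. Adjacent points that end up consecutive were consecutive before,
    so no parallel edges arise between points. *)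
Lemma layered_collapse G Q f k : @layered G Q f ->
  layered [seq x <- Q | f x != k] (unbump k \o f).
Proof.
case=> fQ fstep fsimple; split; first by case: (layers_collapse fQ k).
- move=> e x y /fstep; rewrite !mem_filter /= /unbump.
  by case: (x \in Q) (y \in Q) => [] []; lia.
- move=> e1 e2 x1 y1 x2 y2 xy1 xy2 sub /= fxx fy1 fy2.
  have mem z : z \in [:: x1; y1; x2; y2] -> f z <> k /\ z \in Q.
    by move/sub; rewrite mem_filter => /andP[/eqP].
  have [x1k _] : f x1 <> k /\ x1 \in Q by apply: mem; rewrite inE eqxx.
  have [x2k _] : f x2 <> k /\ x2 \in Q by apply: mem; rewrite !inE eqxx !orbT.
  have s1 := fstep _ _ _ (etrans (same_endsC _ _ _) xy1).
  have s2 := fstep _ _ _ (etrans (same_endsC _ _ _) xy2).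
  apply: (fsimple _ _ _ _ _ _ xy1 xy2); first 1 last.
  - exact: unbump_inj fxx.
  - exact: unbump_succ (leq_addb s1) fy1.
  - exact: unbump_succ (leq_addb s2) fy2.
  by move=> z /mem[].
Qed.

Lemma layered_pullback G H (fV : gV G -> gV H) (fE : gE G -> gE H) Q f :
  injective fV -> injective fE ->
  (forall e, same_ends (gend (fE e)) (map_pair fV (gend e))) ->
  layered (map fV Q) f -> layered Q (f \o fV).
Proof.
move=> injV injE ends [fQ fstep fsimple].
have lift e x y : same_ends (gend e) (x, y) ->
    same_ends (gend (fE e)) (fV x, fV y).
  by move=> /(same_ends_map_pair fV); apply: same_ends_trans.
split; first by rewrite map_comp fQ size_map.
- by move=> e x y /lift /fstep; rewrite !mem_map.
- move=> e1 e2 x1 y1 x2 y2 /lift xy1 /lift xy2 sub fxx fy1 fy2.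
  apply/injE/(fsimple _ _ _ _ _ _ xy1 xy2) => // z.
  rewrite -[[:: _; _; _; _]]/(map fV [:: x1; y1; x2; y2]).
  by case/mapP => w /sub wQ ->; rewrite map_f.
Qed.

Lemma map_preimage (S T : eqType) (h : S -> T) (s : seq T) :
  (forall y, y \in s -> exists x, h x = y) -> exists r, map h r = s.
Proof.
elim: s => [|y s IH] img; first by exists [::].
have [x <-] := img y (mem_head _ _).
have [|r <-] := IH; first by move=> z zs; apply: img; rewrite inE zs orbT.
by exists (x :: r).
Qed.

(** The property called s-layered in the overview; [Q] may be empty. *)
Definition spectators_le (s : nat) (G : graph) : Prop :=
  exists Q f, @layered G Q f /\ #|gV G| <= s + size Q.

Lemma spectators_le_embed s G H (fV : gV G -> gV H) (fE : gE G -> gE H) :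
  bijective fV -> injective fE ->
  (forall e, same_ends (gend (fE e)) (map_pair fV (gend e))) ->
  spectators_le s H -> spectators_le s G.
Proof.
move=> bV injE ends [Q [f [lay le]]]; have [gV fK gK] := bV.
have [|r rE] := @map_preimage _ _ fV Q; first by move=> y _; exists (gV y).
exists r, (f \o fV); split.
  by apply: layered_pullback (bij_inj bV) injE ends _; rewrite rE.
by rewrite (bij_eq_card bV); move: le; rewrite -rE size_map.
Qed.

Lemma spectators_le_del_isolated s G H :
  del_isolated G H -> spectators_le s H -> spectators_le s G.
Proof.
case=> v [fV [fE [_ [injV [nv [img [bE ends]]]]]]] [Q [f [lay le]]].
(* If [v] is not on [Q], this may drop another vertex, the one at level [f v]; either way at most
   one is lost, which the disappearance of [v] pays for. *)
have layQ' := layered_collapse (f v) lay.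
have [|r rE] := @map_preimage _ _ fV [seq x <- Q | f x != f v].
  move=> y; rewrite mem_filter => /andP[fy _].
  by apply: img; apply: contraNneq fy => ->.
exists r, ((unbump (f v) \o f) \o fV); split.
  by apply: layered_pullback injV (bij_inj bE) ends _; rewrite rE.
have ltV : #|gV G| < #|gV H|.
  rewrite -(card_codom injV); apply: proper_card; apply/properP; split.
    by apply/subsetP.
  by exists v => //; apply/codomP => -[x vE]; have := nv x; rewrite vE eqxx.
have [fQ _ _] := lay; have [_] := layers_collapse fQ (f v).
rewrite -rE size_map => szle; rewrite -ltnS.
by apply: leq_trans ltV (leq_trans le _); rewrite -addnS leq_add2l.
Qed.

Lemma spectators_le_contract s G H :
  contract G H -> spectators_le s H -> spectators_le s G.
Proof.
case=> e [fV [fE [_ [ker [fVe [surj [injE [fEe [_ ends]]]]]]]]] [Q [f [lay le]]].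
have [fQ fstep fsimple] := lay.
case eE : (gend e) => [a b] in ker fVe; rewrite /= in fVe.
have ab : same_ends (gend e) (a, b) by rewrite eE /same_ends eqxx.
have fab := fstep _ _ _ ab.
have fba := fstep _ _ _ (etrans (same_endsC _ _ _) ab).
(* The ends of [e] have levels in [{k, k + 1}], which the collapse identifies; hence [f'] is
   constant on the fibres of [fV] and descends to [G]. *)
pose k := minn (f a) (f b); pose f' := unbump k \o f.
pose Q' := [seq x <- Q | f x != k].
have [f'Q' szQ'] := layers_collapse fQ k; rewrite -/Q' -/f' in f'Q' szQ'.
have f'a : f' a = k by rewrite /f' /= /unbump /k; lia.
have f'b : f' b = k by rewrite /f' /= /unbump /k; lia.
have {}ker x y : fV x = fV y -> x <> y ->
    [/\ same_ends (gend e) (x, y), f' x = k, f' y = k & k = minn (f x) (f y)].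
  move=> /ker[] // xy _; have xye : same_ends (gend e) (x, y).
    by rewrite same_ends_sym eE.
  by move: xye; case/orP: xy => /eqP[-> ->] xye; split; rewrite // minnC.
have kerf x y : fV x = fV y -> f' x = f' y.
  by case: (eqVneq x y) => [->//|/eqP ne] /ker[] // _ -> ->.
(* [g] picks a representative of each fibre; [gE] says that levels do not depend on the choice. *)
have [g gK] := fin_all_exists surj.
have gE x : f' (g (fV x)) = f' x by apply: kerf.
(* Two vertices of [Q] are merged only if [e] is the edge of the path between
   levels [k] and [k + 1]. *)
have lost x : fV x \in map fV Q' -> x \notin Q' -> x \in Q /\ (f x = k ->
    exists y, [/\ same_ends (gend e) (x, y), y \in Q & f y = k.+1]).
  case/mapP => y yQ' xy xQ'; have ne : x <> y by move=> E; rewrite E yQ' in xQ'.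
  have [xye f'x f'y kE] := ker _ _ xy ne.
  move: yQ'; rewrite mem_filter => /andP[/eqP fyk yQ].
  have fy : f y = k.+1 by move: f'y; rewrite /f' /= /unbump; lia.
  split; last by exists y.
  have := fstep _ _ _ (etrans (same_endsC _ _ _) xye); rewrite yQ /=.
  case: (x \in Q) => //=; move: f'x; rewrite /f' /= /unbump fy; lia.
have memQ x : fV x \in map fV Q' -> x \in Q.
  move=> xQ; case: (boolP (x \in Q')); first by rewrite mem_filter => /andP[].
  by case/(lost _ xQ).
have edge d z w : same_ends (gend d) (z, w) -> exists x y,
    [/\ same_ends (gend (fE d)) (x, y), fV x = z & fV y = w].
  move=> zw; apply: same_ends_map_pairP.
  by apply: same_ends_trans (ends d); rewrite same_ends_sym.
exists (map fV Q'), (f' \o g); split; last first.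
  have : #|gV G| < #|gV H|.
    rewrite ltn_neqAle (leq_card g (can_inj gK)) andbT.
    apply/eqP => /esym eqV; have gbij := inj_card_bij (can_inj gK) (eq_leq eqV).
    have injV : injective fV by exact: bij_inj (bij_can_bij gbij gK).
    by have := gnoloop e; rewrite eE /= (injV _ _ fVe) eqxx.
  move=> ltV; rewrite size_map -ltnS.
  by apply: leq_trans ltV (leq_trans le _); rewrite -addnS leq_add2l.
split.
- by rewrite -map_comp size_map -f'Q'; apply: eq_map => x /=; exact: gE.
- move=> d z w /edge[x [y [xy <- <-]]]; rewrite /= !gE.
  have := fstep _ _ _ xy.
  case: (boolP (fV x \in _)) => [/memQ xQ|_]; last by rewrite /f' /= /unbump; lia.
  case: (boolP (fV y \in _)) => [_|yQ'] /=; first by rewrite /f' /= /unbump; lia.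
  (* Either [y] is off [Q] and [f x <= f y], or it is the point at level [k] and [f x <= k + 1];
     both give [f' x <= f' y]. *)
  rewrite xQ; have {yQ'} : y \notin Q' by apply: contra yQ' => /(map_f fV).
  by rewrite mem_filter /f' /= /unbump; case: (y \in Q); lia.
- move=> d1 d2 z1 w1 z2 w2 /edge[x1 [y1 [xy1 <- <-]]] /edge[x2 [y2 [xy2 <- <-]]].
  rewrite /= !gE => sub fxx fy1 fy2.
  have mem x : fV x \in [:: fV x1; fV y1; fV x2; fV y2] ->
      x \in Q /\ (f x = k ->
        exists y, [/\ same_ends (gend e) (x, y), y \in Q & f y = k.+1]).
    move=> /sub xQ; split; first exact: memQ.
    case: (boolP (x \in Q')) => [|xQ']; last by have [] := lost _ xQ xQ'.
    by rewrite mem_filter => /andP[/eqP].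
  have [|x1Q x1k] := mem x1; first by rewrite inE eqxx.
  have [|y1Q _] := mem y1; first by rewrite !inE eqxx !orbT.
  have [|x2Q x2k] := mem x2; first by rewrite !inE eqxx !orbT.
  have [|y2Q _] := mem y2; first by rewrite !inE eqxx !orbT.
  have s1 := fstep _ _ _ (etrans (same_endsC _ _ _) xy1).
  have s2 := fstep _ _ _ (etrans (same_endsC _ _ _) xy2).
  (* If [x] were at level [k], then [e] would join it to a point at level [k + 1], as [fE d] does;
     these edges would coincide, but [fE] avoids [e]. *)
  have notk d x y : x \in Q -> y \in Q -> same_ends (gend (fE d)) (x, y) ->
      f y = (f x).+1 ->
      (f x = k -> exists y, [/\ same_ends (gend e) (x, y), y \in Q & f y = k.+1]) ->
      f x <> k.
    move=> xQ yQ xy fy ex fx; have [c [xc cQ fc]] := ex fx.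
    case/eqP: (fEe d).
    apply: (fsimple _ _ _ _ _ _ xy xc); rewrite ?fx ?fy ?fc ?fx //.
    by apply/allP; rewrite /= xQ yQ cQ.
  have f1 := unbump_succ (leq_addb s1) fy1.
  have f2 := unbump_succ (leq_addb s2) fy2.
  have n1 := notk _ _ _ x1Q y1Q xy1 f1 x1k.
  have n2 := notk _ _ _ x2Q y2Q xy2 f2 x2k.
  apply/injE/(fsimple _ _ _ _ _ _ xy1 xy2) => //; last exact: unbump_inj fxx.
  by apply/allP; rewrite /= x1Q y1Q x2Q y2Q.
Qed.

Lemma spectators_le_minor s G H :
  minor G H -> spectators_le s H -> spectators_le s G.
Proof.
elim=> {G H} [H G|G|H K G _ IH1 _ IH2] //; last by move=> /IH1/IH2.
case=> [[e [fV [fE [bV [injE [_ [_ ends]]]]]]]|||[fV [fE [bV [bE ends]]]]].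
- exact: spectators_le_embed bV injE ends.
- exact: spectators_le_del_isolated.
- exact: spectators_le_contract.
- exact: spectators_le_embed bV (bij_inj bE) ends.
Qed.

(** * From a layering back to a unique shortest path *)

(** Going backwards from the end: an interval has no adjacent point one level higher, so the
    predecessor of a point on a climbing walk is a point. *)
Lemma walk_layers_sub G Q f a p es : @layered G Q f -> is_walk (a :: p) es ->
  map f (a :: p) = iota (f a) (size p).+1 -> last a p \in Q ->
  {subset a :: p <= Q}.
Proof.
move=> [_ fstep _]; elim: p a es => [|b p IH] a [|e es] //.
  by move=> _ _ aQ x; rewrite inE => /eqP ->.
rewrite walk_cons same_endsC => /andP[/fstep ab w] [fb fp] lQ.
have sub : {subset b :: p <= Q}.
  by apply: IH w _ lQ; rewrite /= fb fp.
move=> x; rewrite inE => /predU1P[->|/sub //].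
by move: ab; rewrite fb (sub b (mem_head _ _)) /=; case: (a \in Q) => //; lia.
Qed.

Lemma walk_layers_edges G Q f a p es es' : @layered G Q f ->
  {subset a :: p <= Q} -> map f (a :: p) = iota (f a) (size p).+1 ->
  is_walk (a :: p) es -> is_walk (a :: p) es' -> es' = es.
Proof.
move=> [_ _ fsimple].
elim: p a es es' => [|b p IH] a [|e es] [|e' es'] // sub [fb fp].
rewrite !walk_cons => /andP[abe w] /andP[abe' w'].
have subp : {subset b :: p <= Q} by move=> x xp; apply: sub; rewrite inE xp orbT.
congr (_ :: _); last by apply: (IH b) => //; rewrite /= fb fp.
apply: (fsimple _ _ _ _ _ _ abe' abe) => //.
by apply/allP; rewrite /= !sub ?inE ?eqxx ?orbT.
Qed.

(** Climbing from level 0 to [size t] takes at least [size t] edges. A path with exactly that many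
    climbs at every edge, so it stays in [Q], where levels determine vertices and consecutive points
    determine edges. *)
Lemma layered_usp G u t f : @layered G (u :: t) f ->
  path (fun x y => [exists e : gE G, same_ends (gend e) (x, y)]) u t ->
  exists es, is_usp (u :: t) es.
Proof.
move=> lay /path_walk[es w]; exists es, u, (last u t).
have [fQ _ _] := lay; have fL := layered_lipschitz lay.
have fu : f u = 0 by case: fQ.
have fl : f (last u t) = size t.
  by rewrite (last_nth u) (layers_nth fQ).
split; first split.
- by apply/uv_pathP; exists t; split=> //; apply: layers_uniq fQ.
- move=> _ es' /uv_pathP[t' [-> lt' w' _]].
  by have [] := lipschitz_walk fL w'; rewrite lt' fl fu.
move=> _ es' /uv_pathP[t' [-> lt' w' _]] [szt].
have [_] := lipschitz_walk fL w'; rewrite lt' fl fu szt => /(_ erefl) fQ'.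
have sub : {subset u :: t' <= u :: t}.
  by apply: walk_layers_sub lay w' _ _; rewrite ?fu ?szt // lt' mem_last.
have tE : u :: t' = u :: t.
  rewrite -[LHS]map_id -[RHS]map_id.
  have idQ p : {subset p <= u :: t} -> map id p = map (nth u (u :: t)) (map f p).
    move=> subp; rewrite -map_comp; apply/eq_in_map => x /subp xQ /=.
    by rewrite (layers_nthK fQ).
  by rewrite idQ // [RHS]idQ // fQ' fQ.
rewrite tE in w' *; split=> //.
by apply: walk_layers_edges lay _ _ w w'; rewrite ?fu.
Qed.

(** * The parade number as a maximum *)

Lemma usp_ge G vs es : @is_usp G vs es -> size vs <= usp G.
Proof.
move=> U; have lt : size vs < #|gV G|.+1.
  have [u [v [[[/andP[_ uq] _] _] _]]] := U.
  by rewrite ltnS -(card_uniqP uq) max_card.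
rewrite /usp (bigmax_sup (Ordinal lt)) //.
by apply/asboolP; exists vs, es.
Qed.

Lemma usp_attained G : usp G = 0 \/ exists vs es, @is_usp G vs es /\ size vs = usp G.
Proof.
rewrite /usp; elim/big_ind: _ => [|x y|k /asboolP]; [by left| |by right].
by rewrite /maxn; case: ifP.
Qed.

Lemma spectators_le_sp G : spectators_le (sp G) G.
Proof.
rewrite /spectators_le /sp.
case: (usp_attained G) => [->|[vs [es [U szE]]]].
  (* Value 0 is the default of an empty maximum; then [sp G] is [#|gV G|] and the empty [Q]
     suffices. *)
  by exists [::], (fun=> 0); split; [split | rewrite /= addn0 subn0].
have [f lay] := usp_layered U; exists vs, f; split=> //.
by rewrite szE; lia.
Qed.

(** * Adding the missing edges of the path *)

Section Completion.
Variables (G : graph) (u : gV G) (t : seq (gV G)) (f : gV G -> nat).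
Hypothesis lay : layered (u :: t) f.

Let missing (i : 'I_(size t)) :=
  ~~ [exists e : gE G, same_ends (gend e) (nth u (u :: t) i, nth u t i)].

(** [nth u t i] is entry [i.+1] of [u :: t]. An edge is added only between consecutive vertices that
    are not yet adjacent, so it has no parallel edge. *)
Definition completion_end (e : gE G + {i | missing i}) : gV G * gV G :=
  match e with
  | inl e => gend e
  | inr i => (nth u (u :: t) (val i), nth u t (val i))
  end.

Let fQ : map f (u :: t) = iota 0 (size (u :: t)). Proof. by case: lay. Qed.

Let f_src (i : 'I_(size t)) : f (nth u (u :: t) i) = i.
Proof. by rewrite (layers_nth fQ) //= ltnS ltnW. Qed.

Let f_tgt (i : 'I_(size t)) : f (nth u t i) = i.+1.
Proof. by rewrite -[nth u t i]/(nth u (u :: t) i.+1) (layers_nth fQ) //= ltnS. Qed.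

Lemma completion_noloop e : (completion_end e).1 != (completion_end e).2.
Proof.
case: e => [e|[i mi]] /=; first exact: gnoloop.
by apply/eqP => /(congr1 f); rewrite f_src f_tgt; lia.
Qed.

Definition completion : graph :=
  Graph completion_noloop (gnonempty G).

Lemma completion_layered : @layered completion (u :: t) f.
Proof.
have [_ fstep fsimple] := lay.
have srcQ (i : 'I_(size t)) : nth u (u :: t) i \in u :: t.
  by rewrite mem_nth //= ltnS ltnW.
have tgtQ (i : 'I_(size t)) : nth u t i \in u :: t by rewrite inE mem_nth ?orbT.
have new (i : 'I_(size t)) x y : same_ends (nth u (u :: t) i, nth u t i) (x, y) ->
    f y = (f x).+1 -> [/\ x = nth u (u :: t) i, y = nth u t i & f x = i].
  case/orP => /eqP[<- <-]; rewrite f_src f_tgt //; lia.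
have old (i : 'I_(size t)) e x y : same_ends (gend e) (x, y) ->
    x \in u :: t -> y \in u :: t -> f x = i -> f y = i.+1 -> ~~ missing i.
  move=> xy xQ yQ fx fy; rewrite negbK; apply/existsP; exists e.
  rewrite -fx (layers_nthK fQ) // -[nth u t _]/(nth u (u :: t) (f x).+1).
  by rewrite fx -fy (layers_nthK fQ).
split=> //.
- case=> [e|[i mi]] x y; first exact: fstep.
  by case/orP => /eqP[<- <-]; rewrite srcQ tgtQ f_src f_tgt /=; lia.
- move=> e1 e2 x1 y1 x2 y2 xy1 xy2 /allP /and5P[x1Q y1Q x2Q y2Q _] fxx fy1 fy2.
  case: e1 xy1 => [e1|[i mi]] xy1; case: e2 xy2 => [e2|[j mj]] xy2.
  + congr inl; apply: (fsimple _ _ _ _ _ _ xy1 xy2) => //.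
    by apply/allP; rewrite /= x1Q y1Q x2Q y2Q.
  + have [_ _ fj] := new _ _ _ xy2 fy2.
    rewrite -fxx in fj; rewrite fj in fy1.
    by case/negP: (old j _ _ _ xy1 x1Q y1Q fj fy1).
  + have [_ _ fi] := new _ _ _ xy1 fy1.
    rewrite fxx in fi.
    by case/negP: (old i _ _ _ xy2 x2Q y2Q fi (etrans fy2 (congr1 S fi))).
  + have [_ _ fi] := new _ _ _ xy1 fy1; have [_ _ fj] := new _ _ _ xy2 fy2.
    by congr inr; apply/val_inj/val_inj; rewrite /= -fi fxx fj.
Qed.

Lemma completion_usp : exists es, @is_usp completion (u :: t) es.
Proof.
apply: layered_usp completion_layered _; apply/(pathP u) => i lti.
apply/existsP; case: (boolP (missing (Ordinal lti))) => [mi|].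
  by exists (inr (exist missing _ mi)); rewrite /same_ends eqxx.
by rewrite negbK => /existsP[e xy]; exists (inl e).
Qed.

End Completion.

(** * Spanning subgraphs are minors, and the conclusion *)

Lemma same_ends_map_id (T : eqType) (p : T * T) : same_ends p (map_pair id p).
Proof. by case: p => x y; rewrite /same_ends eqxx. Qed.

(** Edges outside the image of [fE] are deleted one by one, by induction on the number of edges of
    [H]; once none is left, the embedding is an isomorphism. *)
Lemma spanning_minor G H (fV : gV G -> gV H) (fE : gE G -> gE H) :
  bijective fV -> injective fE ->
  (forall e, same_ends (gend (fE e)) (map_pair fV (gend e))) -> minor G H.
Proof.
have [n] := ubnP #|gE H|; elim: n H fV fE => // n IH H fV fE ltn bV injE ends.
case: (pselect (exists e, e \notin codom fE)) => [[e ne]|all]; last first.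
  apply: rt_step; apply: Or44; exists fV, fE; split=> //; split=> //.
  apply: inj_card_bij => //.
  rewrite -(card_codom injE); apply/subset_leq_card/subsetP => e _.
  by apply/negPn/negP => ne; apply: all; exists e.
pose H' := Graph (fun d : {d | d != e} => gnoloop (val d)) (gnonempty H).
have neE d : fE d != e by apply: contraNneq ne => <-; exact: codom_f.
have stepH : minor H' H.
  apply: rt_step; apply: Or41; exists e, (@id (gV H)), (fun d : gE H' => val d).
  split; first by exists id.
  split; first exact: val_inj.
  split; first by case.
  split; first by move=> d de; exists (exist _ d de).
  by move=> d; exact: same_ends_map_id.
apply: rt_trans stepH _; apply: (IH H' fV (fun d => exist _ (fE d) (neE d))) => //.
  rewrite -ltnS; apply: leq_trans ltn; rewrite ltnS card_sig.
  apply: proper_card; apply/properP; split; first exact/subsetP.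
  by exists e => //; rewrite unfold_in /= eqxx.
by move=> d1 d2 /(congr1 val) /injE.
Qed.

Lemma spfloor_le G H : minor G H -> spfloor G <= sp H.
Proof.
move=> GH; rewrite /spfloor; case: ex_minnP => s _; apply.
by apply/asboolP; exists H.
Qed.

Lemma spfloor_attained G : exists H, minor G H /\ sp H = spfloor G.
Proof. by rewrite /spfloor; case: ex_minnP => s /asboolP. Qed.

Theorem theorem2p9 (G : graph) :
  exists G' : graph,
    #|gV G'| = #|gV G| /\ subgraph G G' /\ spfloor G = sp G'.
Proof.
have [H [GH spH]] := spfloor_attained G.
have [Q [f [lay le]]] := spectators_le_minor GH (spectators_le_sp H).
have ends (e : gE G) := same_ends_map_id (gend e).
rewrite spH in le; case: Q lay le => [|u t] lay le.
  (* With [Q] empty the floor is at least [#|gV G|], hence at least [sp G], and [G] itself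
     serves. *)
  exists G; split=> //; split; first by exists id, id; split=> //; split.
  apply/eqP; rewrite eqn_leq spfloor_le /=; last exact: rt_refl.
  by apply: leq_trans (leq_subr _ _) _; rewrite /= addn0 in le.
exists (completion lay); split=> //; split.
  by exists id, inl; split=> //; split=> [? ? []|] //.
(* The floor is at most [sp] of the completion because [G] is a minor of it; conversely [Q] is a
   unique shortest path there, leaving at most [spfloor G] spectators. *)
apply/eqP; rewrite eqn_leq spfloor_le /=.
  have [es /usp_ge leU] := completion_usp lay.
  by rewrite leq_subLR addnC; apply: leq_trans le _; rewrite leq_add2l.
apply: (@spanning_minor G (completion lay) id (fun e => inl e)) => //.
  by exists id.
by move=> ? ? [].
Qed.
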